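(* If an s-hypersequent $\alpha_1\vdash\beta_1\mid\dots\mid\alpha_n\vdash\beta_n$ is provable in $\mathbf{PDBL}$, then it is valid in the class $\mathcal{K}$ of all contexts.
   Context: The logic PDBL. Variables: object variables $\mathbf{OV}$ ($p,\dots$) and property variables $\mathbf{PV}$ ($P,\dots$), disjoint countably infinite sets; constants $\top,\bot$; connectives $\sqcap,\sqcup$ (binary), $\neg,\lrcorner$ (unary). $\alpha\vee\beta:=\neg(\neg\alpha\sqcap\neg\beta)$, $\alpha\wedge\beta:=\lrcorner(\lrcorner\alpha\sqcup\lrcorner\beta)$. Sequents $\alpha\vdash\beta$ ($\alpha\dashv\vdash\beta$ means both directions); s-hypersequents are finite sequences $\alpha_1\vdash\beta_1\mid\dots\mid\alpha_n\vdash\beta_n$ (components); $B,C,\dots,X$ range over possibly empty s-hypersequents. Axioms: $\alpha\vdash\alpha$; $\alpha\sqcap\beta\vdash\alpha$; $\alpha\sqcap\beta\vdash\beta$; $\alpha\vdash\alpha\sqcup\beta$; $\beta\vdash\alpha\sqcup\beta$; $\alpha\sqcap\beta\vdash(\alpha\sqcap\beta)\sqcap(\alpha\sqcap\beta)$; $(\alpha\sqcup\beta)\sqcup(\alpha\sqcup\beta)\vdash\alpha\sqcup\beta$; $\neg(\alpha\sqcap\alpha)\vdash\neg\alpha$; $\lrcorner\alpha\vdash\lrcorner(\alpha\sqcup\alpha)$; $\alpha\sqcap\neg\alpha\vdash\bot$; $\top\vdash\alpha\sqcup\lrcorner\alpha$; $\neg\neg(\alpha\sqcap\beta)\dashv\vdash\alpha\sqcap\beta$;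 $\lrcorner\lrcorner(\alpha\sqcup\beta)\dashv\vdash\alpha\sqcup\beta$; $\alpha\sqcap\alpha\vdash\alpha\sqcap(\alpha\sqcup\beta)$; $\alpha\sqcup(\alpha\sqcap\beta)\vdash\alpha\sqcup\alpha$; $\alpha\sqcap\alpha\vdash\alpha\sqcap(\alpha\vee\beta)$; $\alpha\sqcup(\alpha\wedge\beta)\vdash\alpha\sqcup\alpha$; $\alpha\sqcap(\beta\vee\gamma)\dashv\vdash(\alpha\sqcap\beta)\vee(\alpha\sqcap\gamma)$; $\alpha\sqcup(\beta\wedge\gamma)\dashv\vdash(\alpha\sqcup\beta)\wedge(\alpha\sqcup\gamma)$; $\bot\vdash\alpha$; $\alpha\vdash\top$; $\neg\top\vdash\bot$; $\top\vdash\lrcorner\bot$; $\neg\bot\dashv\vdash\top\sqcap\top$; $\lrcorner\top\dashv\vdash\bot\sqcup\bot$; $(\alpha\sqcup\alpha)\sqcap(\alpha\sqcup\alpha)\dashv\vdash(\alpha\sqcap\alpha)\sqcup(\alpha\sqcap\alpha)$; $p\sqcap p\dashv\vdash p$ ($p\in\mathbf{OV}$); $P\sqcup P\dashv\vdash P$ ($P\in\mathbf{PV}$); (Sp) $\alpha\vdash\alpha\sqcap\alpha\mid\alpha\sqcup\alpha\vdash\alpha$. Rules: from $B\mid\alpha\vdash\beta\mid C$ infer $B\mid\alpha\sqcap\gamma\vdash\beta\sqcap\gamma\mid C$, $B\mid\gamma\sqcap\alpha\vdash\gamma\sqcap\beta\mid C$, $B\mid\alpha\sqcup\gamma\vdash\beta\sqcup\gamma\mid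 C$, $B\mid\gamma\sqcup\alpha\vdash\gamma\sqcup\beta\mid C$, $B\mid\neg\beta\vdash\neg\alpha\mid C$, $B\mid\lrcorner\beta\vdash\lrcorner\alpha\mid C$; from $B\mid\alpha\vdash\beta\mid C$ and $D\mid\beta\vdash\gamma\mid E$ infer $B\mid D\mid\alpha\vdash\gamma\mid C\mid E$; from $B\mid\alpha\sqcap\beta\vdash\alpha\sqcap\alpha\mid C$, $D\mid\alpha\sqcap\alpha\vdash\alpha\sqcap\beta\mid E$, $F\mid\alpha\sqcup\beta\vdash\beta\sqcup\beta\mid G$, $H\mid\beta\sqcup\beta\vdash\alpha\sqcup\beta\mid X$ infer $B\mid D\mid F\mid H\mid\alpha\vdash\beta\mid C\mid E\mid G\mid X$; external: from $B\mid D\mid D\mid C$ infer $B\mid D\mid C$; from $B\mid D\mid E\mid C$ infer $B\mid E\mid D\mid C$; from $B$ infer $B\mid C$. Provability is via finite derivations. Contexts and semiconcepts. A context is $\mathbb{K}=(G,M,R)$ with sets $G$ (objects), $M$ (properties), $R\subseteq G\times M$. For $A\subseteq G$, $A'=\{m\in M:gRm\text{ for all }g\in A\}$; for $B\subseteq M$, $B'=\{g\in G:gRm\text{ for all }m\in B\}$. A semiconcept is a pair $(A,B)$ with $A'=B$ or $B'=A$; $\mathfrak{H}(\mathbb{K})$ is the set of semiconcepts, with $ext(A,B)=A$, $int(A,B)=B$, and operations $(A_1,B_1)\sqcap(A_2,B_2)=(A_1\cap A_2,(A_1\cap A_2)')$, $(A_1,B_1)\sqcup(A_2,B_2)=((B_1\cap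 B_2)',B_1\cap B_2)$, $\neg(A,B)=(G\setminus A,(G\setminus A)')$, $\lrcorner(A,B)=((M\setminus B)',M\setminus B)$, $\top=(G,\emptyset)$, $\bot=(\emptyset,M)$. Models. A model is $\mathbb{M}=(\mathbb{K},v)$ with $v$ a map on $\mathbf{OV}\cup\mathbf{PV}\cup\{\top,\bot\}$ into $\mathfrak{H}(\mathbb{K})$ with $v(p)\sqcap v(p)=v(p)$ for $p\in\mathbf{OV}$, $v(P)\sqcup v(P)=v(P)$ for $P\in\mathbf{PV}$, $v(\top)=(G,\emptyset)$, $v(\bot)=(\emptyset,M)$. Satisfaction $\mathbb{M},g\models\alpha$ ($g\in G$) and co-satisfaction $\mathbb{M},m\succ\alpha$ ($m\in M$) are defined by: $g\models p$ iff $g\in ext(v(p))$; $g\models P$ iff $g\in ext(v(P))$; $g\models\top$ always; $g\not\models\bot$ always; $m\not\succ\top$ always; $m\succ\bot$ always; $g\models\alpha\sqcap\beta$ iff $g\models\alpha$ and $g\models\beta$; $g\models\neg\alpha$ iff $g\not\models\alpha$; $m\succ p$ iff $m\in int(v(p))$; $m\succ P$ iff $m\in int(v(P))$; $m\succ\alpha\sqcup\beta$ iff $m\succ\alpha$ and $m\succ\beta$; $m\succ\lrcorner\alpha$ iff $m\not\succ\alpha$; $g\models\alpha\sqcup\beta$ iff for all $m\in M$ ($m\succ\alpha\sqcup\beta\Rightarrow gRm$); $g\models\lrcorner\alpha$ iff for all $m\in M$ ($m\not\succ\alpha\Rightarrow gRm$); $m\succ\neg\alpha$ iff for all $g\in G$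 ($g\not\models\alpha\Rightarrow gRm$); $m\succ\alpha\sqcap\beta$ iff for all $g\in G$ ($g\models\alpha\sqcap\beta\Rightarrow gRm$). A sequent $\alpha\vdash\beta$ is satisfied in $\mathbb{M}$ iff for all $g\in G$, $g\models\alpha$ implies $g\models\beta$, and for all $m\in M$, $m\succ\beta$ implies $m\succ\alpha$. An s-hypersequent is satisfied in $\mathbb{M}$ iff at least one component is; it is true in $\mathbb{K}$ iff satisfied in every model based on $\mathbb{K}$; valid in a class of contexts iff true in each member. *)

(* Defs.v *)
From Stdlib Require List.
From mathcomp Require Import all_boot.
From mathcomp Require Import boolp classical_sets.

Set Implicit Arguments.
Unset Strict Implicit.
Unset Printing Implicit Defensive.

Local Open Scope classical_set_scope.

Declare Scope pdbl_scope.
Delimit Scope pdbl_scope with pdbl.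

(* The object variables and the property variables are two disjoint copies of
   nat; with the two constants they form the domain of valuations. *)
Inductive atom : Type :=
  | OV of nat
  | PV of nat
  | Top
  | Bot.

Inductive formula : Type :=
  | Atom of atom
  | Meet of formula & formula
  | Join of formula & formula
  | Neg of formula
  | LNeg of formula.

Bind Scope pdbl_scope with formula.

Notation "⊤" := (Atom Top) : pdbl_scope.
Notation "⊥" := (Atom Bot) : pdbl_scope.
Notation "¬ a" := (Neg a) (at level 35, right associativity) : pdbl_scope.
Notation "⌟ a" := (LNeg a) (at level 35, right associativity) : pdbl_scope.
Notation "a ⊓ b" := (Meet a b) (at level 40, left associativity) : pdbl_scope.
Notation "a ⊔ b" := (Join a b) (at level 40, left associativity) : pdbl_scope.

Definition Vee (a b : formula) : formula := (¬ (¬ a ⊓ ¬ b))%pdbl.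
Definition Wedge (a b : formula) : formula := (⌟ (⌟ a ⊔ ⌟ b))%pdbl.

Notation "a ∨ b" := (Vee a b) (at level 40, left associativity) : pdbl_scope.
Notation "a ∧ b" := (Wedge a b) (at level 40, left associativity) : pdbl_scope.

Record sequent : Type := Sequent { antecedent : formula; succedent : formula }.

Notation "a ⊢ b" := (Sequent a%pdbl b%pdbl)
  (at level 55, no associativity) : pdbl_scope.

(* Possibly empty; the bar between components is list concatenation. *)
Definition hypersequent : Type := seq sequent.

Local Open Scope pdbl_scope.

Inductive seq_axiom : sequent -> Prop :=
  | ax_id a : seq_axiom (a ⊢ a)
  | ax_meetl a b : seq_axiom (a ⊓ b ⊢ a)
  | ax_meetr a b : seq_axiom (a ⊓ b ⊢ b)
  | ax_joinl a b : seq_axiom (a ⊢ a ⊔ b)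
  | ax_joinr a b : seq_axiom (b ⊢ a ⊔ b)
  | ax_meet_idem a b : seq_axiom (a ⊓ b ⊢ (a ⊓ b) ⊓ (a ⊓ b))
  | ax_join_idem a b : seq_axiom ((a ⊔ b) ⊔ (a ⊔ b) ⊢ a ⊔ b)
  | ax_neg_meet a : seq_axiom (¬ (a ⊓ a) ⊢ ¬ a)
  | ax_lneg_join a : seq_axiom (⌟ a ⊢ ⌟ (a ⊔ a))
  | ax_contradiction a : seq_axiom (a ⊓ ¬ a ⊢ ⊥)
  | ax_excluded_middle a : seq_axiom (⊤ ⊢ a ⊔ ⌟ a)
  | ax_negneg a b : seq_axiom (¬ ¬ (a ⊓ b) ⊢ a ⊓ b)
  | ax_negneg_rev a b : seq_axiom (a ⊓ b ⊢ ¬ ¬ (a ⊓ b))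
  | ax_lneglneg a b : seq_axiom (⌟ ⌟ (a ⊔ b) ⊢ a ⊔ b)
  | ax_lneglneg_rev a b : seq_axiom (a ⊔ b ⊢ ⌟ ⌟ (a ⊔ b))
  | ax_absorb_meet_join a b : seq_axiom (a ⊓ a ⊢ a ⊓ (a ⊔ b))
  | ax_absorb_join_meet a b : seq_axiom (a ⊔ (a ⊓ b) ⊢ a ⊔ a)
  | ax_absorb_meet_vee a b : seq_axiom (a ⊓ a ⊢ a ⊓ (a ∨ b))
  | ax_absorb_join_wedge a b : seq_axiom (a ⊔ (a ∧ b) ⊢ a ⊔ a)
  | ax_distr_meet_vee a b c :
      seq_axiom (a ⊓ (b ∨ c) ⊢ (a ⊓ b) ∨ (a ⊓ c))
  | ax_distr_meet_vee_rev a b c :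
      seq_axiom ((a ⊓ b) ∨ (a ⊓ c) ⊢ a ⊓ (b ∨ c))
  | ax_distr_join_wedge a b c :
      seq_axiom (a ⊔ (b ∧ c) ⊢ (a ⊔ b) ∧ (a ⊔ c))
  | ax_distr_join_wedge_rev a b c :
      seq_axiom ((a ⊔ b) ∧ (a ⊔ c) ⊢ a ⊔ (b ∧ c))
  | ax_bot a : seq_axiom (⊥ ⊢ a)
  | ax_top a : seq_axiom (a ⊢ ⊤)
  | ax_neg_top : seq_axiom (¬ ⊤ ⊢ ⊥)
  | ax_lneg_bot : seq_axiom (⊤ ⊢ ⌟ ⊥)
  | ax_neg_bot : seq_axiom (¬ ⊥ ⊢ ⊤ ⊓ ⊤)
  | ax_neg_bot_rev : seq_axiom (⊤ ⊓ ⊤ ⊢ ¬ ⊥)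
  | ax_lneg_top : seq_axiom (⌟ ⊤ ⊢ ⊥ ⊔ ⊥)
  | ax_lneg_top_rev : seq_axiom (⊥ ⊔ ⊥ ⊢ ⌟ ⊤)
  | ax_double a : seq_axiom ((a ⊔ a) ⊓ (a ⊔ a) ⊢ (a ⊓ a) ⊔ (a ⊓ a))
  | ax_double_rev a : seq_axiom ((a ⊓ a) ⊔ (a ⊓ a) ⊢ (a ⊔ a) ⊓ (a ⊔ a))
  | ax_OV p : seq_axiom (Atom (OV p) ⊓ Atom (OV p) ⊢ Atom (OV p))
  | ax_OV_rev p : seq_axiom (Atom (OV p) ⊢ Atom (OV p) ⊓ Atom (OV p))
  | ax_PV p : seq_axiom (Atom (PV p) ⊔ Atom (PV p) ⊢ Atom (PV p))
  | ax_PV_rev p : seq_axiom (Atom (PV p) ⊢ Atom (PV p) ⊔ Atom (PV p)).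

Inductive provable : hypersequent -> Prop :=
  | pr_axiom s : seq_axiom s -> provable [:: s]
  | pr_Sp a : provable [:: a ⊢ a ⊓ a; a ⊔ a ⊢ a]
  | pr_meet_r B C a b c :
      provable (B ++ [:: a ⊢ b] ++ C) ->
      provable (B ++ [:: a ⊓ c ⊢ b ⊓ c] ++ C)
  | pr_meet_l B C a b c :
      provable (B ++ [:: a ⊢ b] ++ C) ->
      provable (B ++ [:: c ⊓ a ⊢ c ⊓ b] ++ C)
  | pr_join_r B C a b c :
      provable (B ++ [:: a ⊢ b] ++ C) ->
      provable (B ++ [:: a ⊔ c ⊢ b ⊔ c] ++ C)
  | pr_join_l B C a b c :
      provable (B ++ [:: a ⊢ b] ++ C) ->
      provable (B ++ [:: c ⊔ a ⊢ c ⊔ b] ++ C)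
  | pr_neg B C a b :
      provable (B ++ [:: a ⊢ b] ++ C) ->
      provable (B ++ [:: ¬ b ⊢ ¬ a] ++ C)
  | pr_lneg B C a b :
      provable (B ++ [:: a ⊢ b] ++ C) ->
      provable (B ++ [:: ⌟ b ⊢ ⌟ a] ++ C)
  | pr_cut B C D E a b c :
      provable (B ++ [:: a ⊢ b] ++ C) ->
      provable (D ++ [:: b ⊢ c] ++ E) ->
      provable (B ++ D ++ [:: a ⊢ c] ++ C ++ E)
  | pr_order B C D E F G H X a b :
      provable (B ++ [:: a ⊓ b ⊢ a ⊓ a] ++ C) ->
      provable (D ++ [:: a ⊓ a ⊢ a ⊓ b] ++ E) ->
      provable (F ++ [:: a ⊔ b ⊢ b ⊔ b] ++ G) ->
      provable (H ++ [:: b ⊔ b ⊢ a ⊔ b] ++ X) ->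
      provable (B ++ D ++ F ++ H ++ [:: a ⊢ b] ++ C ++ E ++ G ++ X)
  | pr_contraction B C D :
      provable (B ++ D ++ D ++ C) -> provable (B ++ D ++ C)
  | pr_exchange B C D E :
      provable (B ++ D ++ E ++ C) -> provable (B ++ E ++ D ++ C)
  | pr_weakening B C : provable B -> provable (B ++ C).

Local Close Scope pdbl_scope.

Record fcontext : Type := FContext {
  object : Type;
  property : Type;
  incidence : object -> property -> Prop
}.

Section Contexts.
Variable K : fcontext.

Definition intent (A : set (object K)) : set (property K) :=
  [set m | forall g, A g -> incidence g m].

Definition extent (B : set (property K)) : set (object K) :=
  [set g | forall m, B m -> incidence g m].

Definition semiconcepts : set (set (object K) * set (property K)) :=
  [set x | intent x.1 = x.2 \/ extent x.2 = x.1].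

Definition sc_meet (x y : set (object K) * set (property K)) :
    set (object K) * set (property K) :=
  (x.1 `&` y.1, intent (x.1 `&` y.1)).

Definition sc_join (x y : set (object K) * set (property K)) :
    set (object K) * set (property K) :=
  (extent (x.2 `&` y.2), x.2 `&` y.2).

Definition sc_top : set (object K) * set (property K) := (setT, set0).

Definition sc_bot : set (object K) * set (property K) := (set0, setT).

Record model : Type := Model {
  valuation : atom -> set (object K) * set (property K);
  val_semiconcept : forall x, semiconcepts (valuation x);
  val_OV : forall p, sc_meet (valuation (OV p)) (valuation (OV p)) = valuation (OV p);
  val_PV : forall p, sc_join (valuation (PV p)) (valuation (PV p)) = valuation (PV p);
  val_Top : valuation Top = sc_top;
  val_Bot : valuation Bot = sc_bot
}.

Variable V : model.

(* In the clauses for g |= a join b and m >- a meet b, the inner (co-)satisfaction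
   of the compound formula is replaced by its defining conjunction, so that the
   recursion is structural. *)
Fixpoint sat (g : object K) (f : formula) {struct f} : Prop :=
  match f with
  | Atom (OV p) => (valuation V (OV p)).1 g
  | Atom (PV p) => (valuation V (PV p)).1 g
  | Atom Top => True
  | Atom Bot => False
  | Meet a b => sat g a /\ sat g b
  | Neg a => ~ sat g a
  | Join a b => forall m, cosat m a /\ cosat m b -> incidence g m
  | LNeg a => forall m, ~ cosat m a -> incidence g m
  end
with cosat (m : property K) (f : formula) {struct f} : Prop :=
  match f with
  | Atom (OV p) => (valuation V (OV p)).2 m
  | Atom (PV p) => (valuation V (PV p)).2 m
  | Atom Top => False
  | Atom Bot => True
  | Join a b => cosat m a /\ cosat m b
  | LNeg a => ~ cosat m a
  | Neg a => forall g, ~ sat g a -> incidence g m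
  | Meet a b => forall g, sat g a /\ sat g b -> incidence g m
  end.

Definition sat_sequent (s : sequent) : Prop :=
  (forall g, sat g (antecedent s) -> sat g (succedent s)) /\
  (forall m, cosat m (succedent s) -> cosat m (antecedent s)).

Definition sat_hypersequent (S : hypersequent) : Prop :=
  List.Exists sat_sequent S.

End Contexts.

Definition true_in (K : fcontext) (S : hypersequent) : Prop :=
  forall V : model K, sat_hypersequent V S.

Definition valid_in (C : set fcontext) (S : hypersequent) : Prop :=
  forall K, C K -> true_in K S.

(* Main.v *)
Require Import Defs.
From Stdlib Require List.
From mathcomp Require Import all_boot.
From mathcomp Require Import boolp classical_sets.

(* Write a formula as the pair (A, B) of its satisfying objects and co-satisfying
   properties; it is a semiconcept, so B = A' or A = B'.  If B contains A' then a
   sequent with antecedent (A, B) holds as soon as its extents are included;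
   dually, if A contains B' then a sequent with succedent (A, B) holds as soon as
   its intents are included.  Meets and negations are of the first kind, joins and
   opposites of the second, so nearly every axiom and rule becomes an inclusion in
   a power set; (Sp) says that every semiconcept is of one of the two kinds. *)

Set Implicit Arguments.
Unset Strict Implicit.
Unset Printing Implicit Defensive.

Local Open Scope pdbl_scope.

Section Soundness.
Variables (K : fcontext) (V : model K).

Notation "g '⊨' a" := (sat V g a%pdbl) (at level 70).
Notation "m '≻' a" := (cosat V m a%pdbl) (at level 70).
Notation holds s := (sat_sequent V s%pdbl).

(** This is A' ⊆ B; with [sat_cosat_incidence] it becomes B = A', that is, [a] and [a ⊓ a] denote
    the same pair. *)
Definition extent_determined (a : formula) : Prop :=
  forall m, (forall g, g ⊨ a -> incidence g m) -> m ≻ a.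

Definition intent_determined (a : formula) : Prop :=
  forall g, (forall m, m ≻ a -> incidence g m) -> g ⊨ a.

Lemma atom_satE x g : (g ⊨ Atom x) = (valuation V x).1 g.
Proof. by case: x => //=; rewrite ?val_Top ?val_Bot. Qed.

Lemma atom_cosatE x m : (m ≻ Atom x) = (valuation V x).2 m.
Proof. by case: x => //=; rewrite ?val_Top ?val_Bot. Qed.

(** For an atom, either half of the semiconcept condition gives A × B ⊆ R; for a compound formula
    one of the two clauses is by definition the derivation of the other. *)
Lemma sat_cosat_incidence a g m : g ⊨ a -> m ≻ a -> incidence g m.
Proof.
case: a => [x|a b|a b|a|a] /=; try by auto.
rewrite -/(sat V g (Atom x)) -/(cosat V m (Atom x)) atom_satE atom_cosatE.
by case: (val_semiconcept V x) => <- gx mx; [apply: mx|apply: gx].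
Qed.

Lemma determined a : extent_determined a \/ intent_determined a.
Proof.
case: a => [x|a b|a b|a|a]; [|by left|by right|by left|by right].
case: (val_semiconcept V x) => e; [left=> m|right=> g] => H.
  by rewrite atom_cosatE -e => g; rewrite -atom_satE; apply: H.
by rewrite atom_satE -e => m; rewrite -atom_cosatE; apply: H.
Qed.

(** The value of [p] is a meet by [val_OV], and the second coordinate of a meet is derived from the
    first. *)
Lemma extent_determined_OV p : extent_determined (Atom (OV p)).
Proof. by move=> m /= H; rewrite -val_OV => g /= [/H]. Qed.

Lemma intent_determined_PV p : intent_determined (Atom (PV p)).
Proof. by move=> g /= H; rewrite -val_PV => m /= [/H]. Qed.

(** Intents follow by the chain B_b ⊆ A_b' ⊆ A_a' ⊆ B_a. *)
Lemma holds_by_extent a b : extent_determined a ->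
  (forall g, g ⊨ a -> g ⊨ b) -> holds (a ⊢ b).
Proof.
move=> da ab; split=> //= m mb; apply: da => g /ab gb.
exact: sat_cosat_incidence gb mb.
Qed.

Lemma holds_by_intent a b : intent_determined b ->
  (forall m, m ≻ b -> m ≻ a) -> holds (a ⊢ b).
Proof.
move=> db ba; split=> //= g ga; apply: db => m /ba.
exact: sat_cosat_incidence.
Qed.

Lemma axiom_holds s : seq_axiom s -> holds s.
Proof.
have pol := sat_cosat_incidence.
case=> [a|a b|a b|a b|a b|a b|a b|a|a|a|a|a b|a b|a b|a b|a b|a b|a b|a b
       |a b c|a b c|a b c|a b c|a|a| | | | | | |a|a|p|p|p|p].
- by split.
- by apply: holds_by_extent => // g [].
- by apply: holds_by_extent => // g [].
- by apply: holds_by_intent => // m [].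
- by apply: holds_by_intent => // m [].
- by apply: holds_by_extent.
- by apply: holds_by_intent.
- by apply: holds_by_extent => // g /= + ga; apply.
- by apply: holds_by_intent => // m /= + ma; apply.
- by apply: holds_by_extent => // g [].
- by apply: holds_by_intent => // m [].
- by apply: holds_by_extent => // g /contrapT.
- by apply: holds_by_extent => // g gab /=; apply.
- by apply: holds_by_intent => // m mab /=; apply.
- by apply: holds_by_intent => // m /contrapT.
(* Absorption: A_a ⊆ B_a' ⊆ (B_a ∩ B_b)'. *)
- by apply: holds_by_extent => // g [ga _]; split=> // m [ma _]; apply: pol ga ma.
- by apply: holds_by_intent => // m [ma _]; split=> // g [ga _]; apply: pol ga ma.
- by apply: holds_by_extent => // g [ga _]; split=> // -[].
- by apply: holds_by_intent => // m [ma _]; split=> // -[].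
- by apply: holds_by_extent => // g /=; tauto.
(* Extracting [g ⊨ a] from a negated conjunction is classical. *)
- by apply: holds_by_extent => // g /=; have := EM (g ⊨ a); tauto.
- by apply: holds_by_intent => // m /=; have := EM (m ≻ a); tauto.
- by apply: holds_by_intent => // m /=; tauto.
- by apply: holds_by_extent.
- by apply: holds_by_intent.
- by apply: holds_by_extent => // g; apply.
- by apply: holds_by_intent => // m; apply.
- by apply: holds_by_extent.
- by apply: holds_by_extent => // g _ [].
- by apply: holds_by_intent => // m _ [].
- by apply: holds_by_intent.
(* Here g ∈ B' and m ∈ A'. If A' ⊆ B then m ∈ B; if B' ⊆ A then g ∈ A; either way g and m are
   incident. *)
- apply: holds_by_extent => // g [ga _] m [ma _].
  have am h : h ⊨ a -> incidence h m by move=> ha; apply: ma.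
  have ga' n : n ≻ a -> incidence g n by move=> na; apply: ga.
  by case: (determined a) => da; [apply/ga'/da|apply/am/da].
(* From B ⊆ A' and A ⊆ B', deriving once more gives A'' ⊆ B' for extents and B'' ⊆ A' for
   intents. *)
- have ext_int m : m ≻ a -> m ≻ a ⊓ a by move=> ma g [ga _]; apply: pol ga ma.
  have int_ext g : g ⊨ a -> g ⊨ a ⊔ a by move=> ga m [ma _]; apply: pol ga ma.
  split=> [g ga|m ma]; split.
  + by move=> m [/ext_int ma _]; apply: ga.
  + by move=> m [/ext_int ma _]; apply: ga.
  + by move=> g [/int_ext ga _]; apply: ma.
  + by move=> g [/int_ext ga _]; apply: ma.
- by apply: holds_by_extent => // g [].
- by apply: holds_by_extent => //; apply: extent_determined_OV.
- by apply: holds_by_intent => //; apply: intent_determined_PV.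
- by apply: holds_by_intent => // m [].
Qed.

Lemma Sp_holds a : holds (a ⊢ a ⊓ a) \/ holds (a ⊔ a ⊢ a).
Proof.
case: (determined a) => da; [left|right].
  exact: holds_by_extent.
exact: holds_by_intent.
Qed.

(** [a ⊓ a] keeps the extent of [a] and [b ⊔ b] the intent of [b], so one premise yields each
    half. *)
Lemma order_holds a b : holds (a ⊓ a ⊢ a ⊓ b) -> holds (a ⊔ b ⊢ b ⊔ b) ->
  holds (a ⊢ b).
Proof.
move=> [ab _] [_ ba]; split=> [g ga|m mb].
  by have [] := ab g (conj ga ga).
by have [] := ba m (conj mb mb).
Qed.

Lemma sat_hypersequent_cat S T :
  sat_hypersequent V (S ++ T) <-> sat_hypersequent V S \/ sat_hypersequent V T.
Proof. exact: List.Exists_app. Qed.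

Lemma sat_hypersequent1 s : sat_hypersequent V [:: s] <-> sat_sequent V s.
Proof. by rewrite /sat_hypersequent List.Exists_cons List.Exists_nil; tauto. Qed.

(** Reduces a one-premise rule to its active component. *)
Lemma rule_sound B C s t : (sat_sequent V s -> sat_sequent V t) ->
  sat_hypersequent V (B ++ [:: s] ++ C) -> sat_hypersequent V (B ++ [:: t] ++ C).
Proof. by rewrite !sat_hypersequent_cat !sat_hypersequent1; tauto. Qed.

Lemma provable_sat S : provable S -> sat_hypersequent V S.
Proof.
elim=> {S} [s /axiom_holds|a|B C a b c _|B C a b c _|B C a b c _|B C a b c _
  |B C a b _|B C a b _|B C D E a b c _ IH1 _ IH2
  |B C D E F G H X a b _ _ _ + _ + _ _|B C D _|B C D E _|B C _].
- by rewrite sat_hypersequent1.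
- rewrite -[_ :: _]/([:: _] ++ [:: _]) sat_hypersequent_cat !sat_hypersequent1.
  exact: Sp_holds.
- apply: rule_sound => -[ab _].
  by apply: holds_by_extent => // g [ga gc]; split=> //; apply: ab.
- apply: rule_sound => -[ab _].
  by apply: holds_by_extent => // g [gc ga]; split=> //; apply: ab.
- apply: rule_sound => -[_ ba].
  by apply: holds_by_intent => // m [mb mc]; split=> //; apply: ba.
- apply: rule_sound => -[_ ba].
  by apply: holds_by_intent => // m [mc mb]; split=> //; apply: ba.
- apply: rule_sound => -[ab _].
  by apply: holds_by_extent => // g nb ga; apply/nb/ab.
- apply: rule_sound => -[_ ba].
  by apply: holds_by_intent => // m na mb; apply/na/ba.
- have cut : holds (a ⊢ b) -> holds (b ⊢ c) -> holds (a ⊢ c).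
    by move=> [ab ba] [bc cb]; split=> [g /ab/bc|m /cb/ba].
  move: IH1 IH2; rewrite !sat_hypersequent_cat !sat_hypersequent1; tauto.
- have := @order_holds a b.
  rewrite !sat_hypersequent_cat !sat_hypersequent1; tauto.
(* Concatenation is read as disjunction, so the external rules are propositional. *)
- rewrite !sat_hypersequent_cat; tauto.
- rewrite !sat_hypersequent_cat; tauto.
- rewrite sat_hypersequent_cat; tauto.
Qed.

End Soundness.

Theorem theorem66 (S : hypersequent) (hS : provable S) :
  valid_in [set: fcontext]%classic S.
Proof. by move=> K _ V; apply: provable_sat. Qed.
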